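(* Let $G = (V, E)$ be a simple undirected graph with $V = \{v_1, \dots, v_{2n}\}$ and let $\vec{G}$ be an orientation of $G$. Let $\vec{A}$ be the matrix defined below from $\vec{G}$ and regard each edge as a line. Then the set of parity bases of $(\vec{A}, E)$ coincides with the set of perfect matchings of $G$. In addition, if $\vec{G}$ is Pfaffian, then $(\vec{A}, E)$ is a Pfaffian parity with constant $\operatorname{sgn}\vec{M}$, where $M$ is an arbitrary perfect matching of $G$.
   Context: Let $A \in \mathbb{Q}^{V \times 2|E|}$ have rows indexed by $v_1,\dots,v_{2n}$ in this order and two consecutive columns for each edge; for $e=\{v_i,v_j\}$ with $i<j$ the entries of row $v_i$ in these columns are $(1,0)$, those of row $v_j$ are $(0,1)$, and all other rows are $0$ there. $\vec{A}$ is obtained from $A$ by interchanging the two columns of each edge oriented as $(v_i,v_j)$ with $i>j$. For $e$ oriented $(v_i,v_j)$ let $s_e=+1$ if $i<j$ and $-1$ if $i>j$. $F_{2n}$ is the set of permutations $\sigma$ of $\{1,\dots,2n\}$ with $\sigma(1)<\sigma(3)<\cdots<\sigma(2n-1)$ and $\sigma(2i-1)<\sigma(2i)$ for all $i$; a perfect matching $M$ corresponds to the unique $\sigma_M\in F_{2n}$ with $\{v_{\sigma_M(2i-1)},v_{\sigma_M(2i)}\}\in M$ for all $i$. Set $\operatorname{sgn}\vec M = \operatorname{sgn}\sigma_M\prod_{e\in M}s_e$. $\vec G$ is Pfaffian if $\operatorname{sgn}\vec M$ is the same for all perfect matchings $M$. For a matrix whose columns are partitioned into consecutive pairs (lines),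 a parity base is a set of lines whose columns form a nonsingular square submatrix $\vec A[B]$ (original column order); the pair $(\vec A,E)$ is a Pfaffian parity with constant $c\neq 0$ if $\det\vec A[B]=c$ for all parity bases $B$. *)

(* Defs.v *)
From HB Require Import structures.
From mathcomp Require Import all_boot all_order all_fingroup all_algebra.
Set Implicit Arguments.
Unset Strict Implicit.
Unset Printing Implicit Defensive.
Import GRing.Theory.
Local Open Scope ring_scope.

(* Indices start from 0: v_1, ..., v_2n are the elements of 'I_n.*2, and the  *)
(* positions 2i-1 and 2i of the mathematical text, 1 <= i <= n, are            *)
(* pos k false = 2k and pos k true = 2k+1 for k = i-1 : 'I_n.                  *)

Lemma pos_subproof n (i : 'I_n) (b : bool) : (b + i.*2 < n.*2)%N.
Proof. by case: b; rewrite ?add1n ?add0n ?ltn_Sdouble ?ltn_double. Qed.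

Definition pos n (i : 'I_n) (b : bool) : 'I_n.*2 := Ordinal (pos_subproof i b).

Lemma line_of_subproof m (k : 'I_m.*2) : (k./2 < m)%N.
Proof. by rewrite ltn_half_double. Qed.

Definition line_of m (k : 'I_m.*2) : 'I_m := Ordinal (line_of_subproof k).

Section Parity.
Variables (F : fieldType) (r m : nat).
Implicit Types (A : 'M[F]_(r, m.*2)) (B : {set 'I_m}).

Definition line_cols B : {set 'I_m.*2} := [set k | line_of k \in B].

(* enum_val enumerates ordinals increasingly: the column order of A is kept.   *)
Definition sub_lines A B : 'M[F]_(r, #|line_cols B|) :=
  colsub (fun k : 'I_#|line_cols B| => enum_val k) A.

Definition square_sub_lines A B (h : #|line_cols B| = r) : 'M[F]_r :=
  castmx (erefl r, h) (sub_lines A B).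

Definition parity_base A B : Prop :=
  exists h : #|line_cols B| = r, square_sub_lines A h \in unitmx.

Definition pfaffian_parity A (c : F) : Prop :=
  c != 0 /\
  forall B (h : #|line_cols B| = r),
    square_sub_lines A h \in unitmx -> \det (square_sub_lines A h) = c.

End Parity.

Section Graph.
Variable n : nat.
Notation V := 'I_n.*2.
Implicit Types (E M : {set {set V}}) (e : {set V}) (o : rel V) (s : {perm V}).

Definition simple_graph E : Prop := forall e, e \in E -> #|e| = 2.

(* o i j means that the edge {v_i, v_j} is oriented as (v_i, v_j).             *)
Definition orientation E o : Prop :=
  (forall i j : V, o i j -> [set i; j] \in E) /\
  (forall i j : V, [set i; j] \in E -> o i j (+) o j i).

Definition perfect_matching E M : bool :=
  (M \subset E) && [forall v : V, #|[set e in M | v \in e]| == 1%N].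

Definition backward o e : bool :=
  [exists i : V, exists j : V, [&& e == [set i; j], o i j & (j < i)%N]].

Definition edge_sign o e : rat := if backward o e then -1 else 1.

Definition in_F s : bool :=
  [forall i : 'I_n, forall j : 'I_n,
     (i < j)%N ==> (s (pos i false) < s (pos j false))%N] &&
  [forall i : 'I_n, (s (pos i false) < s (pos i true))%N].

Definition perm_of_matching M s : bool :=
  in_F s && [forall i : 'I_n, [set s (pos i false); s (pos i true)] \in M].

(* The default value is irrelevant: when M is a perfect matching there is      *)
(* exactly one s satisfying perm_of_matching M s.                              *)
Definition matching_perm M : {perm V} :=
  odflt 1%g [pick s | perm_of_matching M s].

Definition matching_sgn o M : rat :=
  (-1) ^+ (matching_perm M : bool) * \prod_(e in M) edge_sign o e.

Definition pfaffian_orientation E o : Prop :=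
  forall M M', perfect_matching E M -> perfect_matching E M' ->
    matching_sgn o M = matching_sgn o M'.

(* The order in which the edges occupy the column pairs of A is given by a     *)
(* bijection es from 'I_m to the edge set; in particular m = #|E|.             *)
Definition edge_enumeration m E (es : 'I_m -> {set V}) : Prop :=
  injective es /\ [set es l | l : 'I_m] = E.

Definition smaller_end e (i : V) : bool :=
  [exists j : V, (e == [set i; j]) && (i < j)%N].
Definition larger_end e (i : V) : bool :=
  [exists j : V, (e == [set i; j]) && (j < i)%N].

Definition edge_matrix m (es : 'I_m -> {set V}) : 'M[rat]_(n.*2, m.*2) :=
  \matrix_(i, k) (if odd k then larger_end (es (line_of k)) i
                  else smaller_end (es (line_of k)) i)%:R.

Definition oriented_edge_matrix m (es : 'I_m -> {set V}) o :
    'M[rat]_(n.*2, m.*2) :=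
  \matrix_(i, k)
    let l := line_of k in
    edge_matrix es i (pos l (odd k (+) backward o (es l))).

End Graph.

(* Main.v *)
(* Each column of the oriented edge matrix is the indicator of one vertex: the *)
(* tail of the edge for the first column of a line, the head for the second.   *)
(* So a square submatrix made of whole lines is either singular (two columns   *)
(* name the same vertex) or the matrix of a permutation p, and the latter      *)
(* happens exactly when the chosen edges partition the vertices. Its           *)
(* determinant is the sign of p, which lists the matching as tail, head, tail, *)
(* head and so on. Going from p to the normalized permutation of the matching  *)
(* permutes whole pairs, which is even, and swaps the two entries of each      *)
(* backward edge, which contributes the product of the edge signs.             *)

Require Import Defs.
From mathcomp Require Import all_boot all_order all_fingroup all_algebra.
Set Implicit Arguments.
Unset Strict Implicit.
Unset Printing Implicit Defensive.
Import GRing.Theory.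
Local Open Scope ring_scope.

(** Column [k] of the oriented matrix is the unit vector of one vertex, [col_vertex k]
    ([oriented_edge_matrixE]). A square choice of whole lines is therefore nonsingular exactly when
    its columns name each vertex once, that is, when its edges form a perfect matching
    ([square_sub_lines_unit], [perfect_matching_cols]). Its determinant is then the sign of the
    permutation [p] that reads off tail and head of the chosen lines in order. The normalized
    permutation of the matching lists the same pairs in another order, with exactly the backward
    edges reversed, so [sign_pairs] turns the sign of [p] into [matching_sgn]
    ([det_square_sub_lines]). A Pfaffian orientation makes this value common to all perfect
    matchings. *)

Lemma line_of_pos n (i : 'I_n) b : line_of (pos i b) = i.
Proof. by apply: val_inj; rewrite /= half_bit_double. Qed.

Lemma odd_pos n (i : 'I_n) b : odd (pos i b) = b.
Proof. by rewrite /= oddD odd_double oddb addbF. Qed.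

Lemma pos_line_of n (x : 'I_n.*2) : pos (line_of x) (odd x) = x.
Proof. by apply: val_inj; rewrite /= odd_double_half. Qed.

Lemma pos_inj n (i j : 'I_n) b c : pos i b = pos j c -> i = j /\ b = c.
Proof.
move=> e; split; first by rewrite -(line_of_pos i b) e line_of_pos.
by rewrite -(odd_pos i b) e odd_pos.
Qed.

Lemma ltn_pos n (i j : 'I_n) b c : (i < j)%N -> (pos i b < pos j c)%N.
Proof.
move=> ltij; apply: (@leq_trans j.*2); last exact: leq_addl.
apply: (@leq_trans i.+1.*2); last by rewrite leq_double.
by rewrite doubleS; case: b.
Qed.

Lemma mem_line_cols m (B : {set 'I_m}) l b : (pos l b \in line_cols B) = (l \in B).
Proof. by rewrite inE line_of_pos. Qed.

Lemma card_line_cols m (B : {set 'I_m}) : #|line_cols B| = #|B|.*2.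
Proof.
have -> : line_cols B = (fun u => pos u.1 u.2) @: setX B [set: bool].
  apply/setP => k; apply/idP/imsetP => [|[[l b] /setXP[/= lB _] ->]].
    by rewrite inE => kB; exists (line_of k, odd k);
       rewrite /= ?pos_line_of // !inE kB.
  by rewrite mem_line_cols.
rewrite card_imset; first by rewrite cardsX cardsT card_bool muln2.
by move=> [l b] [l' b'] /pos_inj /= [-> ->].
Qed.

(** * Increasing maps between ordinals *)

Lemma enum_val_increasing m (S : {set 'I_m}) :
  {homo @enum_val _ (mem S) : i j / (i < j)%N}.
Proof.
move=> i j ltij; have x0 := enum_val i.
rewrite !(enum_val_nth x0) -!(nth_map x0 (val x0) val) -?cardE //.
have srt : sorted ltn (map val (enum S)).
  apply: (@subseq_sorted _ ltn ltn_trans _ (map val (enum 'I_m))); last first.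
    by rewrite val_enum_ord iota_ltn_sorted.
  by apply: map_subseq; rewrite {1}/enum_mem enumT filter_subseq.
by apply: (sorted_ltn_nth ltn_trans _ srt) => //; rewrite inE size_map -cardE.
Qed.

Lemma increasing_inj n m (f : 'I_n -> 'I_m) :
  {homo f : i j / (i < j)%N} -> injective f.
Proof.
move=> incf i j eqf; apply: val_inj => /=.
by case: (ltngtP i j) => // /incf; rewrite eqf ltnn.
Qed.

(** Both maps list their common image in sorted order, and a strictly sorted sequence is determined
    by its elements. *)
Lemma increasing_unique n m (f g : 'I_n -> 'I_m) :
  {homo f : i j / (i < j)%N} -> {homo g : i j / (i < j)%N} ->
  f @: setT = g @: setT -> f =1 g.
Proof.
move=> incf incg eqfg.
have srt (h : 'I_n -> 'I_m) : {homo h : i j / (i < j)%N} ->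
    sorted ltn (map (val \o h) (enum 'I_n)).
  move=> inch.
  rewrite (@homo_sorted _ _ _ (relpre val ltn)) //.
  by rewrite -sorted_map val_enum_ord iota_ltn_sorted.
have memE (h : 'I_n -> 'I_m) : map (val \o h) (enum 'I_n) =i
    [seq val x | x in h @: setT].
  move=> v; apply/mapP/imageP => [[k _ ->]|[x /imsetP[k _ ->] ->]].
    by exists (h k); rewrite ?imset_f.
  by exists k; rewrite ?mem_enum.
have /eq_in_map efg : map (val \o f) (enum 'I_n) = map (val \o g) (enum 'I_n).
  apply: (irr_sorted_eq ltn_trans ltnn (srt f incf) (srt g incg)) => v.
  by rewrite !memE eqfg.
by move=> k; apply: val_inj; apply: efg; rewrite mem_enum.
Qed.

Lemma increasing_enum n m (S : {set 'I_m}) (h : #|S| = n) :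
  {homo (fun j => enum_val (cast_ord (esym h) j)) : i j / (i < j)%N} /\
  [set enum_val (cast_ord (esym h) j) | j in [set: 'I_n]] = S.
Proof.
split=> [i j ltij|]; first exact: enum_val_increasing.
apply/setP => x; apply/imsetP/idP => [[j _ ->]|xS]; first exact: enum_valP.
exists (cast_ord h (enum_rank_in xS x)) => //.
by rewrite cast_ordK enum_rankK_in.
Qed.

(** [t i] is the preimage under [key] of the [i]-th smallest value. *)
Lemma sorting_perm n m (key : 'I_n -> 'I_m) : injective key ->
  exists t : {perm 'I_n}, {homo key \o t : i j / (i < j)%N}.
Proof.
move=> key_inj; set S := key @: [set: 'I_n].
have cS : #|S| = n by rewrite card_imset // cardsT card_ord.
have [incS imS] := increasing_enum cS.
have inv i : exists k, key k = enum_val (cast_ord (esym cS) i).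
  have /imsetP[k _ ->] : enum_val (cast_ord (esym cS) i) \in S by exact: enum_valP.
  by exists k.
have [t tE] := fin_all_exists inv.
have t_inj : injective t.
  by move=> i j eqt; apply: (increasing_inj incS); rewrite -!tE eqt.
by exists (perm t_inj) => i j ltij; rewrite /= !permE !tE incS.
Qed.

(** * Signs of permutations that move or reverse pairs of positions *)

Section PairPermutations.
Variable n : nat.
Implicit Types (t : {perm 'I_n}) (p s : {perm 'I_n.*2}) (c : pred 'I_n).

Lemma block_perm_subproof t :
  injective (fun x : 'I_n.*2 => pos (t (line_of x)) (odd x)).
Proof.
move=> x y /pos_inj[/perm_inj eql eqo].
by rewrite -(pos_line_of x) -(pos_line_of y) eql eqo.
Qed.

Definition block_perm t : {perm 'I_n.*2} := perm (@block_perm_subproof t).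

Lemma block_permE t k b : block_perm t (pos k b) = pos (t k) b.
Proof. by rewrite permE line_of_pos odd_pos. Qed.

Lemma perm_posP p s : (forall k b, p (pos k b) = s (pos k b)) -> p = s.
Proof. by move=> eqps; apply/permP => x; rewrite -(pos_line_of x). Qed.

Lemma block_permM t u : block_perm (t * u)%g = (block_perm t * block_perm u)%g.
Proof. by apply: perm_posP => k b; rewrite permM !block_permE permM. Qed.

Lemma block_perm1 : block_perm 1 = 1%g.
Proof. by apply: perm_posP => k b; rewrite block_permE !perm1. Qed.

Lemma block_tperm i j : block_perm (tperm i j) =
  (tperm (pos i false) (pos j false) * tperm (pos i true) (pos j true))%g.
Proof.
have pos_injl b : injective (fun k : 'I_n => pos k b) by move=> k l /pos_inj[].
have stay (k l u : 'I_n) (v : bool) : tperm (pos k v) (pos l v) (pos u (~~ v)) = pos u (~~ v).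
  by rewrite tpermD //; apply/eqP => /pos_inj[_]; case: (v).
apply: perm_posP => k b; rewrite permM block_permE.
case: b; last by rewrite -(inj_tperm _ _ _ (pos_injl false)) (stay _ _ _ true).
by rewrite (stay _ _ _ false) -(inj_tperm _ _ _ (pos_injl true)).
Qed.

(** [block_perm] is a morphism, and it sends a transposition to a product of two, one for each entry
    of the pairs. *)
Lemma odd_block_perm t : block_perm t = false :> bool.
Proof.
have [ts -> dts] := prod_tpermP t; rewrite big_seq.
elim/big_ind: _ => [|u v eu ev|[i j] /(allP dts) /= nij].
- by rewrite block_perm1 odd_perm1.
- by rewrite block_permM odd_permM eu ev.
rewrite block_tperm odd_permM !odd_tperm.
suff ne b : pos i b != pos j b by rewrite !ne.
by apply: contra nij => /eqP/pos_inj[-> _].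
Qed.

Lemma tperm_pos (k l : 'I_n) b :
  tperm (pos k false) (pos k true) (pos l b) = pos l (b (+) (l == k)).
Proof.
have [->|lk] := eqVneq l k.
  by case: b; rewrite ?tpermR ?tpermL.
rewrite tpermD ?addbF //; apply: contra lk => /eqP/pos_inj[-> _] //.
Qed.

Definition flip_perm (r : seq 'I_n) : {perm 'I_n.*2} :=
  (\prod_(k <- r) tperm (pos k false) (pos k true))%g.

Lemma flip_permE r l b :
  uniq r -> flip_perm r (pos l b) = pos l (b (+) (l \in r)).
Proof.
rewrite /flip_perm; elim: r b => [|k r IHr] b /=; first by rewrite big_nil perm1 addbF.
case/andP=> kr ur; rewrite big_cons permM tperm_pos IHr // in_cons -addbA.
by case: eqVneq => //= ->; rewrite (negPf kr).
Qed.

Lemma odd_flip_perm r : flip_perm r = odd (size r) :> bool.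
Proof.
rewrite /flip_perm; elim: r => [|k r IHr]; first by rewrite big_nil odd_perm1.
rewrite big_cons odd_permM IHr odd_tperm.
suff -> : pos k false != pos k true by [].
by apply/eqP => /pos_inj[].
Qed.

(** The hypothesis says that [block_perm t] followed by [p] equals the flips of the pairs in [c]
    followed by [s]. The block part is even, and each flip contributes -1. *)
Lemma sign_pairs p s t c :
  (forall k b, p (pos (t k) b) = s (pos k (b (+) c k))) ->
  (-1) ^+ p = (-1) ^+ s * \prod_k (if c k then -1 else 1) :> rat.
Proof.
move=> psE.
have /(congr1 (@odd_perm _)) : (block_perm t * p = flip_perm (enum c) * s)%g.
  apply: perm_posP => k b.
  by rewrite !permM block_permE psE flip_permE ?enum_uniq // mem_enum.
rewrite !odd_permM odd_block_perm odd_flip_perm -cardE addFb => ->.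
by rewrite signr_addb signr_odd mulrC -big_mkcond prodr_const.
Qed.

(** Reverse each pair whose values descend, then sort the pairs by their smaller value. This
    provides the normalized permutation of a matching. *)
Lemma in_F_normal_form p :
  exists s t c, in_F s /\ forall k b, p (pos (t k) b) = s (pos k (b (+) c k)).
Proof.
pose d k := (p (pos k true) < p (pos k false))%N.
(* The smaller value of the pair [k]. *)
pose key k := p (pos k (d k)).
have key_inj : injective key by move=> k l /perm_inj/pos_inj[].
have [t inct] := sorting_perm key_inj.
pose f x := p (pos (t (line_of x)) (odd x (+) d (t (line_of x)))).
have f_inj : injective f.
  move=> x y /perm_inj/pos_inj[/perm_inj eql].
  by rewrite eql => /addIb eqo; rewrite -(pos_line_of x) -(pos_line_of y) eql eqo.
have sE k b : perm f_inj (pos k b) = p (pos (t k) (b (+) d (t k))).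
  by rewrite permE /f line_of_pos odd_pos.
exists (perm f_inj), t, (d \o t); split=> [|k b]; last by rewrite sE addbK.
apply/andP; split; apply/forallP => k.
  apply/forallP => l; apply/implyP => /inct.
  by rewrite !sE !addFb.
rewrite !sE /d; set x := p (pos _ true); set y := p (pos _ false).
have : (x : nat) != y by apply/eqP => /val_inj/perm_inj/pos_inj[].
by case: (ltngtP x y).
Qed.

End PairPermutations.

(** * Matrices whose columns are unit vectors *)

Lemma det_indicator_mx (R : comNzRingType) N (p : {perm 'I_N}) :
  \det (\matrix_(i, k) (i == p k)%:R : 'M[R]_N) = (-1) ^+ p.
Proof.
rewrite -det_perm -det_tr; congr (\det _).
by apply/matrixP => i k; rewrite !mxE eq_sym.
Qed.

Lemma unitmx_indicator_inj (F : fieldType) N (c : 'I_N -> 'I_N) :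
  (\matrix_(i, k) (i == c k)%:R : 'M[F]_N) \in unitmx -> injective c.
Proof.
rewrite unitmxE unitfE -det_tr => nz x y eqc; apply/eqP; apply: contraNT nz => nxy.
apply/eqP/(determinant_alternate nxy) => i.
by rewrite !mxE eqc.
Qed.

Lemma set2_eq (T : finType) (a b c d : T) : [set a; b] = [set c; d] ->
  (a = c /\ b = d) \/ (a = d /\ b = c).
Proof.
move=> eqs.
have : a \in [set c; d] by rewrite -eqs set21.
have : b \in [set c; d] by rewrite -eqs set22.
have : c \in [set a; b] by rewrite eqs set21.
have : d \in [set a; b] by rewrite eqs set22.
rewrite !inE => /orP[]/eqP hd /orP[]/eqP hc /orP[]/eqP hb /orP[]/eqP ha;
  subst; by [left|right].
Qed.

(** * Parity bases, perfect matchings and their determinants *)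

Section Edges.
Variables (n m : nat) (E : {set {set 'I_n.*2}}) (o : rel 'I_n.*2).
Variable es : 'I_m -> {set 'I_n.*2}.
Hypotheses (simpleE : simple_graph E) (orientE : orientation E o).
Hypothesis enumE : edge_enumeration E es.

Lemma oriented_ends : exists w : 'I_m -> bool -> 'I_n.*2, forall l,
  [/\ es l = [set w l false; w l true], w l false != w l true,
      o (w l false) (w l true) & ~~ o (w l true) (w l false)].
Proof.
have ends l : exists u : 'I_n.*2 * 'I_n.*2,
    [/\ es l = [set u.1; u.2], u.1 != u.2, o u.1 u.2 & ~~ o u.2 u.1].
  have lE : es l \in E by rewrite -enumE.2 imset_f.
  have /eqP/cards2P[x [y [nxy dl]]] := simpleE lE.
  have := orientE.2 x y; rewrite -dl => /(_ lE).
  case oxy: (o x y); case oyx: (o y x) => // _; first by exists (x, y); rewrite /= oyx.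
  by exists (y, x); rewrite /= setUC eq_sym oxy.
have [u uE] := fin_all_exists ends.
by exists (fun l b => if b then (u l).2 else (u l).1).
Qed.

(* w l false is the tail of the edge of line l, and w l true its head. *)
Variable w : 'I_m -> bool -> 'I_n.*2.
Hypothesis wP : forall l,
  [/\ es l = [set w l false; w l true], w l false != w l true,
      o (w l false) (w l true) & ~~ o (w l true) (w l false)].

Lemma ends_inj l b c : w l b = w l c -> b = c.
Proof.
have [_ /eqP ne _ _] := wP l.
by case: b c => [] [] // /esym // /esym.
Qed.

Lemma in_edge l v : reflect (exists b, v = w l b) (v \in es l).
Proof.
have [-> _ _ _] := wP l; rewrite !inE.
by apply: (iffP orP) => [[]/eqP->|[[] ->]]; [exists false|exists true|right|left].
Qed.

Lemma backward_ends l : backward o (es l) = (w l true < w l false)%N.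
Proof.
have [dl ne owl nowl] := wP l.
apply/existsP/idP => [[i /existsP[j]]|ltw]; last first.
  by exists (w l false); apply/existsP; exists (w l true); rewrite dl eqxx owl.
rewrite dl => /and3P[/eqP/set2_eq[] [<- <-]] // owl'.
by rewrite owl' in nowl.
Qed.

Lemma smaller_end_ends l i :
  smaller_end (es l) i = (i == w l (w l true < w l false)%N).
Proof.
have [dl ne _ _] := wP l; rewrite /smaller_end dl.
have nv : (w l false : nat) != w l true by [].
apply/existsP/eqP => [[j /andP[/eqP/set2_eq[] [<- <-]] lt]|->].
- by rewrite ltnNge ltnW.
- by rewrite lt.
exists (w l (~~ (w l true < w l false)%N)).
by case: (ltngtP (w l true) (w l false)) nv => //= -> _; rewrite ?eqxx // setUC eqxx.
Qed.

Lemma larger_end_ends l i :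
  larger_end (es l) i = (i == w l (w l false < w l true)%N).
Proof.
have [dl ne _ _] := wP l; rewrite /larger_end dl.
have nv : (w l false : nat) != w l true by [].
apply/existsP/eqP => [[j /andP[/eqP/set2_eq[] [<- <-]] lt]|->].
- by rewrite ltnNge ltnW.
- by rewrite lt.
exists (w l (~~ (w l false < w l true)%N)).
by case: (ltngtP (w l false) (w l true)) nv => //= -> _; rewrite ?eqxx // setUC eqxx.
Qed.

Definition col_vertex (k : 'I_m.*2) := w (line_of k) (odd k).

Lemma col_vertex_pos l b : col_vertex (pos l b) = w l b.
Proof. by rewrite /col_vertex line_of_pos odd_pos. Qed.

(** In [edge_matrix] the smaller end comes first; interchanging the columns of the backward edges
    puts the tail first everywhere. *)
Lemma oriented_edge_matrixE i k :
  oriented_edge_matrix es o i k = (i == col_vertex k)%:R.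
Proof.
rewrite mxE /= mxE line_of_pos odd_pos backward_ends smaller_end_ends larger_end_ends.
rewrite /col_vertex; set l := line_of k.
have [_ ne _ _] := wP l; have {ne} : (w l false : nat) != w l true by [].
by case: (odd k); case: ltngtP.
Qed.

(** If each vertex lies in exactly one edge, equal labels force equal edges, hence equal columns,
    and every vertex is a label. Conversely, an injective labelling of 2n columns by 2n vertices is
    onto. *)
Lemma perfect_matching_cols (B : {set 'I_m}) :
  perfect_matching E (es @: B) <->
  #|line_cols B| = n.*2 /\ {in line_cols B &, injective col_vertex}.
Proof.
have [es_inj dE] := enumE; split=> [/andP[_ /forallP matchB]|[cB injB]].
  have injB : {in line_cols B &, injective col_vertex}.
    move=> k k'; rewrite -(pos_line_of k) -(pos_line_of k') !mem_line_cols.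
    rewrite !col_vertex_pos => kB k'B eqw.
    have /cards1P[e de] := matchB (w (line_of k) (odd k)).
    have inM l b : l \in B -> w (line_of k) (odd k) = w l b -> es l = e.
      move=> lB dw; apply/set1P; rewrite -de inE imset_f //=.
      by apply/in_edge; exists b.
    have eql : line_of k = line_of k'.
      by apply: es_inj; rewrite (inM _ _ kB erefl) (inM _ _ k'B eqw).
    by rewrite -eql in eqw *; rewrite (ends_inj eqw).
  split=> //; rewrite -(card_in_imset injB).
  have -> : col_vertex @: line_cols B = setT; last by rewrite cardsT card_ord.
  apply/setP => v; rewrite !inE.
  have /cards1P[e de] := matchB v.
  have : e \in [set e in es @: B | v \in e] by rewrite de set11.
  rewrite inE => /andP[/imsetP[l lB ->] /in_edge[b ->]].
  by rewrite -col_vertex_pos imset_f // mem_line_cols.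
apply/andP; split.
  by apply/subsetP => e /imsetP[l _ ->]; rewrite -dE imset_f.
apply/forallP => v.
have /imsetP[k kB dv] : v \in col_vertex @: line_cols B.
  suff -> : col_vertex @: line_cols B = setT by rewrite inE.
  by apply/eqP; rewrite eqEcard subsetT cardsT card_ord card_in_imset ?cB /=.
apply/cards1P; exists (es (line_of k)); apply/setP => e; rewrite !inE.
apply/andP/eqP => [[/imsetP[l lB ->] /in_edge[b]]|->]; last first.
  split; first by rewrite imset_f //; rewrite inE in kB.
  by apply/in_edge; exists (odd k).
rewrite dv -col_vertex_pos => /injB ->; rewrite ?mem_line_cols //.
by rewrite line_of_pos.
Qed.

Lemma square_sub_linesE (B : {set 'I_m}) (h : #|line_cols B| = n.*2) :
  square_sub_lines (oriented_edge_matrix es o) h =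
  \matrix_(i, k) (i == col_vertex (enum_val (cast_ord (esym h) k)))%:R.
Proof.
apply/matrixP => i k.
by rewrite castmxE !mxE -oriented_edge_matrixE cast_ord_id !mxE.
Qed.

Lemma square_sub_lines_perm (B : {set 'I_m}) (h : #|line_cols B| = n.*2) :
  {in line_cols B &, injective col_vertex} ->
  exists p : {perm 'I_n.*2},
    (forall k, p k = col_vertex (enum_val (cast_ord (esym h) k))) /\
    square_sub_lines (oriented_edge_matrix es o) h =
      \matrix_(i, k) (i == p k)%:R.
Proof.
move=> inj; pose c k := col_vertex (enum_val (cast_ord (esym h) k)).
have c_inj : injective c.
  by move=> x y /inj eqw; apply: cast_ord_inj (enum_val_inj (eqw _ _));
     apply: enum_valP.
exists (perm c_inj); split=> [k|]; first by rewrite permE.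
by rewrite square_sub_linesE; apply/matrixP => i k; rewrite !mxE permE.
Qed.

Lemma square_sub_lines_unit (B : {set 'I_m}) (h : #|line_cols B| = n.*2) :
  square_sub_lines (oriented_edge_matrix es o) h \in unitmx <->
  {in line_cols B &, injective col_vertex}.
Proof.
split=> [|inj].
  rewrite square_sub_linesE => /unitmx_indicator_inj inj k k' kB k'B eqw.
  have sel x (xB : x \in line_cols B) :
      x = enum_val (cast_ord (esym h) (cast_ord h (enum_rank_in xB x))).
    by rewrite cast_ordK enum_rankK_in.
  rewrite (sel k kB) (sel k' k'B) in eqw *.
  by rewrite (inj _ _ eqw).
have [p [_ ->]] := square_sub_lines_perm h inj.
by rewrite unitmxE det_indicator_mx unitrX ?unitrN1.
Qed.

Lemma parity_baseP (B : {set 'I_m}) :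
  parity_base (oriented_edge_matrix es o) B <-> perfect_matching E (es @: B).
Proof.
split=> [[h /square_sub_lines_unit inj]|/perfect_matching_cols[h inj]].
  exact/perfect_matching_cols.
by exists h; apply/square_sub_lines_unit.
Qed.

Lemma matching_sgn_neq0 M : matching_sgn o M != 0.
Proof.
rewrite mulf_neq0 ?signr_eq0 //; apply/prodf_neq0 => e _.
by rewrite /edge_sign; case: ifP.
Qed.

Lemma det_square_sub_lines (B : {set 'I_m}) (h : #|line_cols B| = n.*2) :
  square_sub_lines (oriented_edge_matrix es o) h \in unitmx ->
  \det (square_sub_lines (oriented_edge_matrix es o) h) = matching_sgn o (es @: B).
Proof.
move=> /square_sub_lines_unit inj; have [es_inj _] := enumE.
have cB : #|B| = n by apply: double_inj; rewrite -card_line_cols.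
have [incg img] := increasing_enum cB.
have [incf imf] := increasing_enum h.
move: img incg; set g := fun k => enum_val (cast_ord (esym cB) k) => img incg.
have g_inj := increasing_inj incg.
(* The selected columns keep the lines contiguous: both sides increase and have image
   [line_cols B]. *)
have colE k b : enum_val (cast_ord (esym h) (pos k b)) = pos (g k) b.
  pose g2 (x : 'I_n.*2) := pos (g (line_of x)) (odd x).
  rewrite (_ : pos (g k) b = g2 (pos k b)); last by rewrite /g2 line_of_pos odd_pos.
  apply: (increasing_unique incf) => [x y ltxy|].
    rewrite /g2; case: (ltngtP (line_of x) (line_of y)) => [ltl|ltl|/val_inj eql].
    - by apply/ltn_pos/incg.
    - have := ltn_pos (odd y) (odd x) ltl.
      by rewrite !pos_line_of ltnNge ltnW.
    move: ltxy; rewrite -{1}(pos_line_of x) -{1}(pos_line_of y) eql /=.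
    by rewrite !ltn_add2r.
  rewrite imf; apply/setP => x; rewrite -[x]pos_line_of mem_line_cols.
  apply/idP/imsetP => [|[y _ /pos_inj[-> _]]]; last by rewrite -img imset_f.
  rewrite -{1}img => /imsetP[l _ ->]; exists (pos l (odd x)) => //.
  by rewrite /g2 line_of_pos odd_pos.
have [p [pcolE ->]] := square_sub_lines_perm h inj.
have pE k b : p (pos k b) = w (g k) b by rewrite pcolE colE col_vertex_pos.
rewrite det_indicator_mx /matching_sgn /matching_perm.
have esE k : es (g k) = [set p (pos k false); p (pos k true)].
  by rewrite !pE; have [] := wP (g k).
(* The default of [matching_perm] is never reached: normalizing [p] yields a permutation for the
   matching. *)
case: pickP => [s /andP[Fs /forallP sM]|noperm] /=; last first.
  have [s [t [d [Fs psE]]]] := in_F_normal_form p.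
  suff : perm_of_matching (es @: B) s by rewrite noperm.
  rewrite /perm_of_matching Fs /=; apply/forallP => k.
  rewrite (_ : [set _; _] = es (g (t k))) ?imset_f ?enum_valP //.
  by rewrite esE !psE; case: (d k) => //=; rewrite setUC.
have pair k : exists j, es (g j) = [set s (pos k false); s (pos k true)].
  have /imsetP[l] := sM k.
  by rewrite -{1}img => /imsetP[j _ ->] ->; exists j.
have [t tE] := fin_all_exists pair.
have t_inj : injective t.
  move=> k k' eqt; have := tE k; rewrite eqt tE => /set2_eq.
  by case=> [[/perm_inj/pos_inj[-> _] _]|[/perm_inj/pos_inj[_]]].
(* Since [s] is increasing on each pair, it disagrees with the order tail, head exactly at the
   backward edges. *)
have psE k b : p (pos (perm t_inj k) b) = s (pos k (b (+) backward o (es (g (t k))))).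
  rewrite permE !pE backward_ends.
  have lts : (s (pos k false) < s (pos k true))%N by case/andP: Fs => _ /forallP.
  have := tE k; rewrite esE !pE => /set2_eq[] [w0 w1]; rewrite w0 w1.
    by rewrite ltnNge ltnW //; case: b; rewrite ?w0 ?w1.
  by rewrite lts; case: b; rewrite ?w0 ?w1.
rewrite (sign_pairs psE); congr (_ * _).
have -> : es @: B = (es \o g \o t) @: setT.
  apply/setP => e; apply/imsetP/imsetP => [[l]|[k _ ->]].
    rewrite -{1}img => /imsetP[j _ ->] ->.
    by exists ((perm t_inj)^-1%g j); rewrite //= -(permE t_inj) permKV.
  by exists (g (t k)); rewrite ?enum_valP.
rewrite big_imset /=; last by move=> k k' _ _ /es_inj/g_inj/t_inj.
by apply: eq_bigl => k; rewrite inE.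
Qed.

End Edges.

Theorem theorem3p10 (n m : nat) (E : {set {set 'I_n.*2}}) (o : rel 'I_n.*2)
    (es : 'I_m -> {set 'I_n.*2})
    (simpleE : simple_graph E) (orientE : orientation E o)
    (enumE : edge_enumeration E es) :
  (forall M : {set {set 'I_n.*2}},
     (exists2 B : {set 'I_m},
        parity_base (oriented_edge_matrix es o) B & M = es @: B)
     <-> perfect_matching E M) /\
  (pfaffian_orientation E o ->
   forall M : {set {set 'I_n.*2}}, perfect_matching E M ->
     pfaffian_parity (oriented_edge_matrix es o) (matching_sgn o M)).
Proof.
have [w wP] := oriented_ends simpleE orientE enumE.
have baseP := parity_baseP enumE wP.
split=> [M|pfaffE M matchM].
  split=> [[B /baseP matchB -> //]|matchM].
  (* The lines of [M] recover it, because [M] lies in the image [E] of [es]. *)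
  have dM : M = es @: (es @^-1: M).
    apply/setP => e; apply/idP/imsetP => [eM|[l]]; last by rewrite inE => ? ->.
    have : e \in E by have /andP[/subsetP-> //] := matchM.
    by rewrite -enumE.2 => /imsetP[l _ de]; exists l; rewrite // inE -de.
  by exists (es @^-1: M) => //; apply/baseP; rewrite -dM.
split=> [|B h unitB]; first exact: matching_sgn_neq0.
rewrite (det_square_sub_lines enumE wP unitB); apply: pfaffE => //.
by apply/baseP; exists h.
Qed.
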